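(* Let $\alpha>-1$ and for $n\ge1$ let $L^{QC}_n(x;0)=\mathcal L^{(\alpha+1)}_n(x)+(n+\alpha+1)\mathcal L^{(\alpha+1)}_{n-1}(x)$, with recurrence coefficients $\lambda^{qc}_{n+1}=(n-1)(n+\alpha+1)$ and $c^{qc}_{n+1}=2n+\alpha+1$. Exactly one zero of $L^{QC}_n(x;0)$ lies at $x=0$, the finite end point of the support of the Laguerre measure. Nevertheless, the sequence $$\tilde s_n(0)=\frac{\lambda^{qc}_{n+1}}{c^{qc}_n\,c^{qc}_{n+1}}=\frac{(n-1)(n+\alpha+1)}{(2n+\alpha+1)(2n+\alpha-1)},\qquad n\ge2,$$ is a chain sequence: $\tilde s_n(0)=(1-\tilde m_{n-1}(0))\,\tilde m_n(0)$ for all $n\ge2$, where the parameter sequence, given by $\tilde m_1(0)=0$ and $$\tilde m_n(0)=1-\lim_{x\to0}\frac{L^{QC}_{n+1}(x;0)}{(x-c^{qc}_{n+1})\,L^{QC}_n(x;0)}\quad(n\ge2),$$ equals $$\tilde m_n(0)=\frac{n-1}{2n+\alpha+1},\qquad n\ge1,$$ and is the minimal parameter sequence (as $\tilde m_1(0)=0$). Moreover, for all $n\ge2$, $\tilde m_n(0)>0$ and $$\tilde m_n(0)\le\frac12\Bigl(1-\frac1n\Bigr)<\frac12 .$$ Thus the complementary chain sequence of the chain sequence $(\tilde s_n(0))_{n\ge2}$ is a single parameter positive chain sequence (SPPCS).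
   Context: For $a>-1$, $\mathcal L^{(a)}_n(x)$ denotes the monic Laguerre polynomial of degree $n$, defined by $\mathcal L^{(a)}_{-1}=0$, $\mathcal L^{(a)}_0=1$ and $\mathcal L^{(a)}_{n+1}(x)=(x-(2n+a+1))\mathcal L^{(a)}_n(x)-n(n+a)\mathcal L^{(a)}_{n-1}(x)$ for $n\ge0$. The Laguerre measure is $x^{\alpha}e^{-x}dx$ on $(0,\infty)$. The recurrence coefficients $\lambda^{qc}_{n+1}$, $c^{qc}_{n+1}$ are those in $L^{QC}_{n+1}(x;0)=(x-c^{qc}_{n+1})L^{QC}_n(x;0)-\lambda^{qc}_{n+1}L^{QC}_{n-1}(x;0)$. A sequence $(s_n)_{n\ge2}$ is a chain sequence if there is a parameter sequence $(d_n)_{n\ge1}$ with $d_1\in[0,1)$, $d_n\in(0,1)$ for $n\ge2$, and $s_n=(1-d_{n-1})d_n$ for $n\ge2$. The minimal parameter sequence is the one whose initial term is $0$. If $(m_n)_{n\ge1}$ is the minimal parameter sequence of $(s_n)_{n\ge2}$, the complementary chain sequence is $((1-k_{n-1})k_n)_{n\ge2}$ with $k_1=0$ and $k_n=1-m_n$ for $n\ge2$. A chain sequence is a single parameter positive chain sequence (SPPCS) if it has only one parameter sequence, i.e. its minimal and maximal parameter sequences coincide. For each $n\ge1$, $x$ is a factor of $L^{QC}_n(x;0)$; the value at $x=0$ of the quotient defining $\tilde m_n$ is understood after cancelling this common factor, i.e. as a limit. *)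

(* Defs.v *)
From mathcomp Require Import all_boot all_order all_algebra.
From mathcomp Require Import all_classical all_reals all_analysis.

Set Implicit Arguments.
Unset Strict Implicit.
Unset Printing Implicit Defensive.

Import Order.TTheory GRing.Theory Num.Theory.
Import numFieldNormedType.Exports.
Local Open Scope classical_set_scope.
Local Open Scope ring_scope.

(* The pair (L_n^(a), L_{n-1}^(a)) of consecutive monic Laguerre polynomials,
   which makes the convention L_{-1}^(a) = 0 available at n = 0. *)
Fixpoint laguerre_pair (R : realType) (a : R) (n : nat) :
    {poly R} * {poly R} :=
  if n is m.+1 then
    let: (p, q) := laguerre_pair a m in
    (('X - (2 * m%:R + a + 1)%:P) * p - (m%:R * (m%:R + a))%:P * q, p)
  else (1, 0).

Definition laguerre (R : realType) (a : R) (n : nat) : {poly R} :=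
  (laguerre_pair a n).1.

(* laguerre_pred a n is L_{n-1}^(a), with value 0 at n = 0. *)
Definition laguerre_pred (R : realType) (a : R) (n : nat) : {poly R} :=
  (laguerre_pair a n).2.

Definition LQC (R : realType) (alpha : R) (n : nat) : {poly R} :=
  laguerre (alpha + 1) n
  + (n%:R + alpha + 1)%:P * laguerre_pred (alpha + 1) n.

(* The formulas are those for the index m.+1 with 1 <= m; the values at the
   indices 0 and 1 are irrelevant. *)
Definition lambda_qc (R : realType) (alpha : R) (n : nat) : R :=
  if n is m.+1 then (m%:R - 1) * (m%:R + alpha + 1) else 0.

Definition c_qc (R : realType) (alpha : R) (n : nat) : R :=
  if n is m.+1 then 2 * m%:R + alpha + 1 else 0.

Definition recurrence_coefficients (R : realType) (P : nat -> {poly R})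
    (lam c : nat -> R) : Prop :=
  forall n : nat, (1 <= n)%N ->
    P n.+1 = ('X - (c n.+1)%:P) * P n - (lam n.+1)%:P * P n.-1.

Definition laguerre_measure (R : realType) (alpha : R) (A : set R) : \bar R :=
  (\int[lebesgue_measure]_(x in A `&` `]0%R, +oo[) (x `^ alpha * expR (- x))%R%:E)%E.

Definition measure_support (R : realType) (mu : set R -> \bar R) : set R :=
  [set x | forall U : set R, open U -> U x -> (0 < mu U)%E].

(* Sequences (s_n)_{n >= 2} and (d_n)_{n >= 1} are functions on nat whose values
   at smaller indices are irrelevant. *)
Definition parameter_sequence (R : realType) (s d : nat -> R) : Prop :=
  [/\ 0 <= d 1%N < 1,
      (forall n : nat, (2 <= n)%N -> 0 < d n < 1)
    & (forall n : nat, (2 <= n)%N -> s n = (1 - d n.-1) * d n)].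

Definition chain_sequence (R : realType) (s : nat -> R) : Prop :=
  exists d : nat -> R, parameter_sequence s d.

Definition minimal_parameter_sequence (R : realType) (s m : nat -> R) : Prop :=
  parameter_sequence s m /\ m 1%N = 0.

Definition complementary_parameter (R : realType) (m : nat -> R) (n : nat) : R :=
  if (n <= 1)%N then 0 else 1 - m n.

Definition complementary_chain_sequence (R : realType) (s t : nat -> R) : Prop :=
  exists m : nat -> R, minimal_parameter_sequence s m /\
    forall n : nat, (2 <= n)%N ->
      t n = (1 - complementary_parameter m n.-1) * complementary_parameter m n.

Definition SPPCS (R : realType) (s : nat -> R) : Prop :=
  chain_sequence s /\
  forall d d' : nat -> R, parameter_sequence s d -> parameter_sequence s d' ->
    forall n : nat, (1 <= n)%N -> d n = d' n.

Definition s_qc (R : realType) (alpha : R) (n : nat) : R :=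
  lambda_qc alpha n.+1 / (c_qc alpha n * c_qc alpha n.+1).

Definition quotient_qc (R : realType) (alpha : R) (n : nat) (x : R) : R :=
  (LQC alpha n.+1).[x] / ((x - c_qc alpha n.+1) * (LQC alpha n).[x]).

Definition m_qc (R : realType) (alpha : R) (n : nat) : R :=
  if (n <= 1)%N then 0
  else 1 - lim (quotient_qc alpha n x @[x --> (0 : R)^']).

(* Main.v *)
Require Import Defs.
From mathcomp Require Import all_boot all_order all_algebra.
From mathcomp Require Import all_classical all_reals all_analysis.
From mathcomp Require Import measurable_realfun ring lra.

Set Implicit Arguments.
Unset Strict Implicit.
Unset Printing Implicit Defensive.

Import Order.TTheory GRing.Theory Num.Theory.
Import numFieldNormedType.Exports.
Local Open Scope classical_set_scope.
Local Open Scope ring_scope.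

(** Everything rests on the factorisation LQC_factor: the quasi-orthogonal
    polynomial of degree n + 1 is x times the monic Laguerre polynomial of
    degree n with parameter alpha + 2.  The recurrence is then that of the
    Laguerre polynomials, the zero at 0 is simple because Laguerre polynomials
    do not vanish there (laguerre_at0_neq0), and the limit that defines m_qc is a ratio
    of values at 0, which laguerre_at0S evaluates.  With
    m_n = (n - 1) / (2n + alpha + 1) in closed form, the chain sequence identity
    and the bound by 1/2 are rational function computations.

    The conclusion on the complementary sequence is a general fact
    (complementary_SPPCS): if the minimal parameters m_n are at most 1/2, the
    complementary parameters k_n = 1 - m_n are at least 1/2, and a second parameter
    sequence d of the same chain sequence would make the positive quantity
    (1 - k_n) / (d_n - k_n) drop by at least 1 at each step
    (half_parameter_unique). *)

(** * Laguerre polynomials and the quasi-orthogonal family *)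

Lemma laguerreS (R : realType) (a : R) (n : nat) :
  laguerre a n.+1 = ('X - (2 * n%:R + a + 1)%:P) * laguerre a n
                    - (n%:R * (n%:R + a))%:P * laguerre_pred a n.
Proof.
by rewrite /laguerre /laguerre_pred /=; case: (laguerre_pair a n).
Qed.

Lemma laguerre_predS (R : realType) (a : R) (n : nat) :
  laguerre_pred a n.+1 = laguerre a n.
Proof.
by rewrite /laguerre /laguerre_pred /=; case: (laguerre_pair a n).
Qed.

(** The contiguous relation between the parameters a + 1 and a.  Two
    consecutive degrees are carried together because the recurrence has order
    two; in the step, the defect between the two sides is n + a + 2 times the
    three-term recurrence for the parameter a, hence zero. *)
Lemma laguerre_parameter_shift (R : realType) (a : R) (n : nat) :
  'X * laguerre (a + 1) n
  = laguerre a n.+1 + (n.+1%:R + a)%:P * laguerre a n.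
Proof.
have [//] : 'X * laguerre (a + 1) n
              = laguerre a n.+1 + (n.+1%:R + a)%:P * laguerre a n
         /\ 'X * laguerre (a + 1) n.+1
              = laguerre a n.+2 + (n.+2%:R + a)%:P * laguerre a n.+1.
elim: n => [|n [IH0 IH1]].
  rewrite !(laguerreS, laguerre_predS) /laguerre /laguerre_pred /=.
  by split; rewrite ?(polyCD, polyCM, polyC0, polyC1, polyCB); ring.
split=> //.
rewrite (laguerreS (a + 1)) laguerre_predS mulrBr mulrCA IH1.
rewrite [X in _ - X]mulrCA IH0 (laguerreS a n.+2) (laguerreS a n.+1).
rewrite !laguerre_predS.
rewrite -!natr1 !(polyCD, polyCM, polyC1); ring.
Qed.

(** The zero at the end point of the support is explicit: removing it leaves
    a Laguerre polynomial whose parameter is larger by 2, so that recurrence,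
    multiplicity and limit all reduce to facts on Laguerre polynomials. *)
Lemma LQC_factor (R : realType) (alpha : R) (n : nat) :
  LQC alpha n.+1 = 'X * laguerre (alpha + 2) n.
Proof.
have -> : alpha + 2 = alpha + 1 + 1 by lra.
by rewrite laguerre_parameter_shift /LQC laguerre_predS addrA.
Qed.

(** Combining the recurrence at 0 with the induction hypothesis cancels
    the term of order two, so the values at 0 obey a recurrence of order one;
    the limit of the quotient is read off from its ratio. *)
Lemma laguerre_at0S (R : realType) (a : R) (n : nat) :
  (laguerre a n.+1).[0] = - (n%:R + a + 1) * (laguerre a n).[0].
Proof.
elim: n => [|n IH].
  by rewrite laguerreS /laguerre /= !hornerE; ring.
rewrite laguerreS laguerre_predS !hornerE [in LHS]IH IH -natr1; ring.
Qed.

Lemma laguerre_at0_neq0 (R : realType) (a : R) (n : nat) :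
  -1 < a -> (laguerre a n).[0] != 0.
Proof.
move=> a_gt; elim: n => [|n IH]; first by rewrite /laguerre /= hornerE oner_eq0.
rewrite laguerre_at0S mulf_neq0 // oppr_eq0 gt_eqF //.
by have : 0 <= n%:R :> R by []; lra.
Qed.

Lemma LQC_recurrence (R : realType) (alpha : R) :
  recurrence_coefficients (LQC alpha) (lambda_qc alpha) (c_qc alpha).
Proof.
case=> [//|[|n]] _ /=.
  (* The lower index is 0, where there is no factor 'X; but lambda_qc 2 = 0. *)
  rewrite !LQC_factor laguerreS /laguerre /laguerre_pred /LQC /=.
  rewrite !(polyCD, polyCM, polyCB, polyC0, polyC1); ring.
rewrite !LQC_factor laguerreS laguerre_predS -!natr1.
rewrite !(polyCD, polyCM, polyCB, polyC0, polyC1); ring.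
Qed.

Lemma mup0_LQC (R : realType) (alpha : R) (n : nat) :
  -1 < alpha -> mup 0 (LQC alpha n.+1) = 1%N.
Proof.
move=> halpha; rewrite LQC_factor mupMl; last first.
  by rewrite rootE laguerre_at0_neq0 //; lra.
by have := mup_XsubCX 1 (0 : R) 0; rewrite expr1 subr0 eqxx.
Qed.

Lemma c_qc_gt0 (R : realType) (alpha : R) (n : nat) :
  -1 < alpha -> 0 < c_qc alpha n.+1.
Proof. by move=> halpha /=; have : 0 <= n%:R :> R by []; lra. Qed.

(** Away from 0 the common factor x cancels, and what remains is a rational
    function continuous at 0, since a Laguerre polynomial does not vanish
    there. *)
Lemma quotient_qc_cvg (R : realType) (alpha : R) (n : nat) :
  -1 < alpha -> (0 < n)%N ->
  quotient_qc alpha n x @[x --> (0 : R)^']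
    --> 1 - (n%:R - 1) / (2 * n%:R + alpha + 1).
Proof.
case: n => [//|n] halpha _.
pose L k := laguerre (alpha + 2) k.
pose c := c_qc alpha n.+2.
have c_gt0 : 0 < c by exact: c_qc_gt0.
have L0 : (L n).[0] != 0 by rewrite laguerre_at0_neq0 //; lra.
have -> : 1 - (n.+1%:R - 1) / (2 * n.+1%:R + alpha + 1)
          = (L n.+1).[0] / ((0 - c) * (L n).[0]).
  have := c_gt0; rewrite /L laguerre_at0S /c /= => c0.
  field; rewrite -natr1 in c0; rewrite L0 /= gt_eqF //; lra.
have reduced : (L n.+1).[x] / ((x - c) * (L n).[x]) @[x --> (0 : R)^']
    --> (L n.+1).[0] / ((0 - c) * (L n).[0]).
  apply: cvg_within_filter.
  apply: cvgM; first exact: continuous_horner.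
  apply: cvgV; first by rewrite mulf_neq0 // sub0r oppr_eq0 gt_eqF.
  apply: cvgM; last exact: continuous_horner.
  by apply: cvgB; [exact: cvg_id | exact: cvg_cst].
apply: cvg_trans reduced; apply: near_eq_cvg.
apply: filterS (nbhs_dnbhs_neq _) => x x0.
rewrite /quotient_qc !LQC_factor !hornerM hornerX mulrCA.
by rewrite -mulf_div divff // mul1r.
Qed.

(** * The support of the Laguerre measure *)

(** A negative alpha makes x^alpha decreasing; writing it as
    x^(alpha + 1) / x gives one bound for all alpha > -1, by monotony of each
    factor. *)
Lemma laguerre_weight_ge (R : realType) (alpha c d x : R) :
  -1 < alpha -> 0 < c -> c <= x <= d ->
  c `^ (alpha + 1) / d * expR (- d) <= x `^ alpha * expR (- x).
Proof.
move=> halpha c0 /andP[cx xd].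
have x0 : 0 < x by exact: lt_le_trans cx.
have d0 : 0 < d by exact: lt_le_trans xd.
have -> : x `^ alpha = x `^ (alpha + 1) / x.
  rewrite powRD; last by rewrite (gt_eqF x0) implybT.
  by rewrite powRr1 ?ltW // mulfK // gt_eqF.
have exp_le : expR (- d) <= expR (- x) by rewrite ler_expR lerN2.
apply: ler_pM exp_le; rewrite ?expR_ge0 ?divr_ge0 ?powR_ge0 ?(ltW d0) //.
have inv_le : d^-1 <= x^-1 by rewrite lef_pV2.
apply: ler_pM inv_le; rewrite ?powR_ge0 ?invr_ge0 ?(ltW d0) //.
by apply: ge0_ler_powR; rewrite ?nnegrE //; lra.
Qed.

Lemma measurable_laguerre_weight (R : realType) (alpha : R) (D : set R) :
  measurable_fun D (fun x : R => (x `^ alpha * expR (- x))%:E).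
Proof.
apply/measurable_EFinP/measurable_funTS.
apply: measurable_funM; first exact: measurable_powR.
exact: measurableT_comp.
Qed.

(** A negative point has the neighbourhood of the negative reals, of measure
    zero.  Any neighbourhood of x >= 0 contains a segment [c, d] with
    0 < c < d, also when x = 0, and the weight is bounded below there by a
    positive constant. *)
Lemma laguerre_measure_support (R : realType) (alpha : R) :
  -1 < alpha -> measure_support (laguerre_measure alpha) = `[0, +oo[%classic.
Proof.
move=> halpha; apply/seteqP; split => x /=; rewrite in_itv /= andbT.
  move=> supp; rewrite leNgt; apply/negP => x0.
  have := supp `]-oo, 0[%classic (@lray_open _ R 0).
  rewrite /= in_itv /= => /(_ x0); rewrite /laguerre_measure.
  suff -> : `]-oo, 0[%classic `&` `]0, +oo[%classic = set0 :> set R.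
    by rewrite integral_set0 ltxx.
  apply/seteqP; split => // y [] /=; rewrite !in_itv /= andbT => y0 y0'.
  by have := lt_trans y0 y0'; rewrite ltxx.
move=> x0 U oU Ux.
have /nbhs_ballP[e /= e0 eU] : nbhs x U by exact: open_nbhs_nbhs.
pose c := x + e / 4; pose d := x + e / 2.
have c0 : 0 < c by rewrite /c; lra.
have cd : c < d by rewrite /c /d; lra.
pose k := c `^ (alpha + 1) / d * expR (- d).
have k0 : 0 < k.
  by rewrite /k mulr_gt0 ?expR_gt0 ?divr_gt0 ?powR_gt0 //; lra.
have sub : `[c, d]%classic `<=` U `&` `]0, +oo[%classic.
  move=> y /=; rewrite !in_itv /= andbT => /andP[cy yd]; split; last by lra.
  apply: eU; rewrite /ball /= distrC ger0_norm; last by rewrite /c in cy; lra.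
  by rewrite /d in yd; lra.
have w_ge0 y : (0 <= (y `^ alpha * expR (- y))%:E)%E.
  by rewrite lee_fin mulr_ge0 ?powR_ge0 ?expR_ge0.
have mk : (0 < \int[lebesgue_measure]_(y in `[c, d]) k%:E)%E.
  rewrite integral_cst //= lebesgue_measure_itv /= lte_fin cd.
  by rewrite mule_gt0 ?lte_fin // subr_gt0.
apply: (lt_le_trans mk); rewrite /laguerre_measure.
apply: (@le_trans _ _ (\int[lebesgue_measure]_(y in `[c, d])
                          (y `^ alpha * expR (- y))%:E)%E).
  apply: ge0_le_integral => //=.
  - by move=> y _; rewrite lee_fin ltW.
  - exact: measurable_laguerre_weight.
  - move=> y; rewrite in_itv /= => ycd; rewrite lee_fin.
    exact: laguerre_weight_ge.
apply: ge0_subset_integral => //.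
- by apply: measurableI => //; exact: open_measurable.
- exact: measurable_laguerre_weight.
Qed.

(** * Chain sequences *)

Lemma parameter_sequence_lt1 (R : realType) (s d : nat -> R) (n : nat) :
  parameter_sequence s d -> (1 <= n)%N -> d n < 1.
Proof.
move=> [/andP[_ d1] dn _]; case: n => [//|[|n]] _ //.
by have /andP[] := dn n.+2 isT.
Qed.

Lemma parameter_sequence_uniq (R : realType) (s d d' : nat -> R) :
  parameter_sequence s d -> parameter_sequence s d' -> d 1%N = d' 1%N ->
  forall n : nat, (1 <= n)%N -> d n = d' n.
Proof.
move=> dP d'P dd'1; case=> [//|n] _; elim: n => [//|n IH].
have [_ _ /(_ n.+2 isT) sd] := dP; have [_ _ /(_ n.+2 isT)] := d'P.
rewrite sd /= -IH; apply: mulfI.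
by rewrite subr_eq0 gt_eqF // (parameter_sequence_lt1 dP).
Qed.

(* d 1 > 0 impossible *)
(** Uniqueness when the minimal parameters k are at least 1/2.  Put
    e_n = d_n - k_n for another parameter sequence d.  Equating the two
    factorisations of t gives (1 - d_n) e_(n+1) = e_n k_(n+1), so e_1 > 0 would
    make every e_n positive.  Then u_n = (1 - k_n) / e_n exceeds 1 because
    d_n < 1, while u_(n+1) = (u_n - 1) (1 - k_(n+1)) / k_(n+1) <= u_n - 1, which is
    impossible for all n.  This bypasses Wall's criterion that the sum of the
    products of k_j / (1 - k_j) diverges. *)
Lemma half_parameter_unique (R : realType) (t k d : nat -> R) :
  k 1%N = 0 -> (forall n, (2 <= n)%N -> 2^-1 <= k n) ->
  parameter_sequence t k -> parameter_sequence t d -> d 1%N = 0.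
Proof.
move=> k1 k_ge kP dP.
have k_lt1 n : k n.+1 < 1 by exact: (parameter_sequence_lt1 kP).
have d_lt1 n : d n.+1 < 1 by exact: (parameter_sequence_lt1 dP).
have [/andP[d1_ge0 _] _ td] := dP; have [_ _ tk] := kP.
apply/eqP; rewrite eq_le d1_ge0 andbT leNgt; apply/negP => d1_gt0.
(* Indices are shifted by one: e n and u n belong to the parameter n.+1. *)
pose e n : R := d n.+1 - k n.+1.
have step n : (1 - d n.+1) * e n.+1 = e n * k n.+2.
  by have := td n.+2 isT; rewrite tk // /e /= => tE; lra.
have e_gt0 n : 0 < e n.
  elim: n => [|n IH]; first by rewrite /e k1 subr0.
  have k2 := k_ge n.+2 isT.
  rewrite -(pmulr_rgt0 _ (_ : 0 < 1 - d n.+1)) ?subr_gt0 // step.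
  by rewrite mulr_gt0 //; lra.
pose u n : R := (1 - k n.+1) / e n.
have u_gt1 n : 1 < u n.
  by rewrite /u ltr_pdivlMr // mul1r /e; have := d_lt1 n; lra.
have u_dec n : u n.+1 <= u n - 1.
  have k2 := k_ge n.+2 isT.
  have -> : u n - 1 = k n.+2 / e n.+1.
    have e0 := e_gt0 n; have e1 := e_gt0 n.+1; have st := step n.
    have -> : k n.+2 = (1 - d n.+1) * e n.+1 / e n.
      by rewrite st mulrAC mulfV ?mul1r // gt_eqF.
    have -> : 1 - d n.+1 = 1 - k n.+1 - e n by rewrite /e; ring.
    by rewrite /u; field; rewrite !gt_eqF.
  by rewrite /u ler_pM2r ?invr_gt0 //; lra.
have u_le n : u n <= u 0%N - n%:R.
  elim: n => [|n IH]; first by rewrite subr0.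
  by rewrite -natr1; have := u_dec n; lra.
have [n un] : exists n : nat, u 0%N < n%:R.
  by exists (Num.bound (u 0%N)); rewrite archi_boundP // ltW // (lt_trans ltr01).
by have := u_le n; have := u_gt1 n; lra.
Qed.

Lemma complementary_parameterP (R : realType) (s m t : nat -> R) :
  minimal_parameter_sequence s m ->
  (forall n : nat, (2 <= n)%N ->
     t n = (1 - complementary_parameter m n.-1) * complementary_parameter m n) ->
  parameter_sequence t (complementary_parameter m).
Proof.
move=> [[_ m01 _] _] tE; split=> //; first by rewrite /= lexx ltr01.
by case=> [|[|n]] // _ /=; have /andP[] := m01 n.+2 isT; rewrite subr_gt0 ltrBlDr ltrDl => -> ->.
Qed.

(** A complementary sequence refers to some minimal parameter sequence m' of
    s, which agrees with m because the first term determines the others; so its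
    parameters 1 - m' n are at least 1/2. *)
Lemma complementary_SPPCS (R : realType) (s m t : nat -> R) :
  minimal_parameter_sequence s m ->
  (forall n : nat, (2 <= n)%N -> m n <= 2^-1) ->
  complementary_chain_sequence s t -> SPPCS t.
Proof.
move=> mP m_le [m' [m'P tE]].
have kP := complementary_parameterP m'P tE.
have d1_eq0 d : parameter_sequence t d -> d 1%N = 0.
  apply: half_parameter_unique kP; first by [].
  case=> [|[|n]] // _; rewrite /complementary_parameter /=.
  have [dm' m'1] := m'P; have [dm m1] := mP.
  rewrite (parameter_sequence_uniq dm' dm) ?m1 //.
  by have := m_le n.+2 isT; lra.
split; first by exists (complementary_parameter m').
move=> d d' dP d'P; apply: (parameter_sequence_uniq dP d'P).
by rewrite !d1_eq0.
Qed.

(** * The parameter sequence in closed form *)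

Lemma m_qcE (R : realType) (alpha : R) (n : nat) : -1 < alpha -> (0 < n)%N ->
  m_qc alpha n = (n%:R - 1) / (2 * n%:R + alpha + 1).
Proof.
rewrite /m_qc; case: n => [//|[|n]] halpha _; first by rewrite subrr mul0r.
rewrite ltnS leqn0 /=.
by rewrite (cvg_lim (@Rhausdorff R) (quotient_qc_cvg halpha _)) // subKr.
Qed.

Lemma m_qc_gt0 (R : realType) (alpha : R) (n : nat) : -1 < alpha -> (2 <= n)%N ->
  0 < m_qc alpha n.
Proof.
move=> halpha n2; have n2R : 2 <= n%:R :> R by rewrite ler_nat.
by rewrite m_qcE // ?(ltnW n2) // divr_gt0 //; lra.
Qed.

Lemma m_qc_le (R : realType) (alpha : R) (n : nat) : -1 < alpha -> (2 <= n)%N ->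
  m_qc alpha n <= 2^-1 * (1 - n%:R^-1).
Proof.
move=> halpha n2; have n2R : 2 <= n%:R :> R by rewrite ler_nat.
rewrite m_qcE // ?(ltnW n2) //.
have -> : 2^-1 * (1 - n%:R^-1) = (n%:R - 1) / (2 * n%:R) :> R.
  by field; rewrite gt_eqF //; lra.
by rewrite ler_pM2l ?lef_pV2 ?posrE; lra.
Qed.

Lemma half_1subV_lt (R : realType) (n : nat) : (2 <= n)%N ->
  (2^-1 * (1 - n%:R^-1) : R) < 2^-1.
Proof.
move=> n2; have : 0 < n%:R^-1 :> R by rewrite invr_gt0 ltr0n ltnW.
by lra.
Qed.

Lemma s_qcE (R : realType) (alpha : R) (n : nat) : (2 <= n)%N ->
  s_qc alpha n = (n%:R - 1) * (n%:R + alpha + 1)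
                 / ((2 * n%:R + alpha + 1) * (2 * n%:R + alpha - 1)).
Proof.
case: n => [|n] // _; rewrite /s_qc /= -natr1 [X in _ / X]mulrC.
by congr (_ / (_ * _)); ring.
Qed.

Lemma s_qc_m_qc (R : realType) (alpha : R) (n : nat) : -1 < alpha -> (2 <= n)%N ->
  s_qc alpha n = (1 - m_qc alpha n.-1) * m_qc alpha n.
Proof.
case: n => [|[|n]] // halpha _.
rewrite s_qcE // !m_qcE //= -!natr1; have : 0 <= n%:R :> R by [].
by move=> n0; field; rewrite !gt_eqF //; lra.
Qed.

Lemma m_qc_minimal (R : realType) (alpha : R) : -1 < alpha ->
  minimal_parameter_sequence (s_qc alpha) (m_qc alpha).
Proof.
move=> halpha; split=> //; split=> [|n n2|n n2]; last exact: s_qc_m_qc.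
  by rewrite /m_qc lexx ltr01.
rewrite m_qc_gt0 //=; have := m_qc_le halpha n2; have := half_1subV_lt R n2.
by lra.
Qed.

Theorem mainTheorem8 (R : realType) (alpha : R) (halpha : -1 < alpha) :
  recurrence_coefficients (LQC alpha) (lambda_qc alpha) (c_qc alpha) /\
  (forall n : nat, (1 <= n)%N -> mup 0 (LQC alpha n) = 1%N) /\
  measure_support (laguerre_measure alpha) = `[0, +oo[%classic /\
  (forall n : nat, (2 <= n)%N ->
     s_qc alpha n =
       (n%:R - 1) * (n%:R + alpha + 1)
       / ((2 * n%:R + alpha + 1) * (2 * n%:R + alpha - 1))) /\
  chain_sequence (s_qc alpha) /\
  (forall n : nat, (2 <= n)%N ->
     s_qc alpha n = (1 - m_qc alpha n.-1) * m_qc alpha n) /\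
  (forall n : nat, (2 <= n)%N ->
     cvg (quotient_qc alpha n x @[x --> (0 : R)^'])) /\
  (forall n : nat, (1 <= n)%N ->
     m_qc alpha n = (n%:R - 1) / (2 * n%:R + alpha + 1)) /\
  minimal_parameter_sequence (s_qc alpha) (m_qc alpha) /\
  (forall n : nat, (2 <= n)%N ->
     [/\ 0 < m_qc alpha n,
         m_qc alpha n <= 2^-1 * (1 - n%:R^-1)
       & (2^-1 * (1 - n%:R^-1) : R) < 2^-1]) /\
  (exists t : nat -> R, complementary_chain_sequence (s_qc alpha) t) /\
  (forall t : nat -> R, complementary_chain_sequence (s_qc alpha) t -> SPPCS t).
Proof.
have mP := m_qc_minimal halpha.
split; first exact: LQC_recurrence.
split; first by case=> // n _; exact: mup0_LQC.
split; first exact: laguerre_measure_support.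
split; first by move=> n; exact: s_qcE.
split; first by exists (m_qc alpha); case: mP.
split; first by move=> n; exact: s_qc_m_qc.
split.
  move=> n n2; apply/cvg_ex; eexists; apply: quotient_qc_cvg => //.
  exact: ltnW.
split; first by move=> n; exact: m_qcE.
split=> //.
split.
  by move=> n n2; split; [exact: m_qc_gt0 | exact: m_qc_le | exact: half_1subV_lt].
split; last first.
  move=> t; apply: complementary_SPPCS mP _ => n n2.
  exact: le_trans (m_qc_le halpha n2) (ltW (half_1subV_lt R n2)).
pose k := complementary_parameter (m_qc alpha).
by exists (fun n => (1 - k n.-1) * k n), (m_qc alpha).
Qed.
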